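(* Let $h(x)$ be a polynomial with real coefficients, let $A$ be an arbitrary $(m+1)$-dimensional unitary algebra over $K$ ($K=\mathbb{R}$ or $\mathbb{C}$) with basis $\{e_0,e_1,\dots,e_m\}$, and let $Q_{h,n}(x)=\sum_{k=0}^{m}F_{h,n+k}(x)\,e_k$ ($n\ge 0$) be the $h(x)$-Fibonacci polynomials in $A$. Then the generating function $G(t)=\sum_{n=0}^{\infty}Q_{h,n}(x)\,t^{n}$ of the sequence $\{Q_{h,n}(x)\}_{n=0}^{\infty}$ is of the form $$G(t)=\frac{Q_{h,0}(x)+\bigl(Q_{h,1}(x)-h(x)Q_{h,0}(x)\bigr)t}{1-h(x)t-t^{2}}.$$
   Context: The real $h(x)$-Fibonacci polynomials $F_{h,n}(x)$ are defined by $F_{h,0}(x)=0$, $F_{h,1}(x)=1$ and $F_{h,n}(x)=h(x)F_{h,n-1}(x)+F_{h,n-2}(x)$ for $n\ge 2$. The variable $x$ is real, and $G(t)$ is a formal power series in $t$ with coefficients in $A$; the scalar power series $1-h(x)t-t^2$ is invertible, and the quotient denotes multiplication by its inverse. The algebra $A$ has a unit and a $K$-bilinear product; it is not assumed associative or commutative. *)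

(* Defs.v *)
From HB Require Import structures.
From mathcomp Require Import all_boot all_order all_algebra.
From mathcomp Require Import boolp reals.
From mathcomp.real_closed Require Import complex.

Set Implicit Arguments.
Unset Strict Implicit.
Unset Printing Implicit Defensive.

Import GRing.Theory.
Local Open Scope ring_scope.

(* A finite-dimensional algebra with a unit, neither associative nor
   commutative in general; the library's [falgType] would force
   associativity. *)
HB.mixin Record Vector_isUnitaryAlg (K : fieldType) A of Vector K A := {
  uamul : A -> A -> A;
  uaone : A;
  uamul_linear_l : forall v, linear (fun u => uamul u v);
  uamul_linear_r : forall u, linear (uamul u);
  uamul1v : left_id uaone uamul;
  uamulv1 : right_id uaone uamul
}.

#[short(type="unitaryAlgType")]
HB.structure Definition UnitaryAlg (K : fieldType) :=
  {A of Vector_isUnitaryAlg K A & Vector K A}.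

Variant scalar_kind := RealScalars | ComplexScalars.

Definition scalars (R : realType) (k : scalar_kind) : fieldType :=
  match k with
  | RealScalars => R
  | ComplexScalars => R[i]
  end.

Definition of_real (R : realType) (k : scalar_kind) :
    {rmorphism R -> scalars R k} :=
  match k return {rmorphism R -> scalars R k} with
  | RealScalars => idfun : {rmorphism R -> R}
  | ComplexScalars => real_complex R : {rmorphism R -> R[i]}
  end.

Fixpoint hfib (R : realType) (h : {poly R}) (n : nat) : {poly R} :=
  match n with
  | 0 => 0
  | n1.+1 => match n1 with
             | 0 => 1
             | n2.+1 => h * hfib h n1 + hfib h n2
             end
  end.

Definition hfibA (R : realType) (k : scalar_kind) (m : nat)
    (A : unitaryAlgType (scalars R k)) (e : m.+1.-tuple A)
    (h : {poly R}) (x : R) (n : nat) : A :=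
  \sum_(j < m.+1) of_real R k (hfib h (n + j)).[x] *: tnth e j.

(* [u : fps V] is the formal power series in t with coefficient [u n] at t^n;
   addition and product of series are not the pointwise ones. *)
Definition fps (V : Type) : Type := nat -> V.

Definition gen_fun (V : Type) (u : nat -> V) : fps V := u.

(* s_0 + s_1 t + s_2 t^2 + ...; also applies to [{poly V}], which coerces
   to its sequence of coefficients. *)
Definition fps_of_seq (V : nmodType) (s : seq V) : fps V := fun n => s`_n.

(* Cauchy product of a scalar series with a series with coefficients in V;
   V := K^o gives the product of scalar series. *)
Definition fps_act (K : fieldType) (V : lmodType K) (a : fps K) (u : fps V) :
    fps V :=
  fun n => \sum_(i < n.+1) a i *: u (n - i)%N.

Section Inverse.
Variables (K : fieldType) (a : fps K).

(* First n coefficients of the inverse series b, obtained by solving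
   a_0 b_n + \sum_(i < n) a_(n - i) b_i = [n = 0] for b_n. *)
Fixpoint fps_inv_coefs (n : nat) : seq K :=
  if n is n1.+1 then
    let s := fps_inv_coefs n1 in
    rcons s ((a 0)^-1 * ((n1 == 0)%:R - \sum_(i < n1) a (n1 - i)%N * s`_i))
  else [::].

Definition fps_inv : fps K := fun n => (fps_inv_coefs n.+1)`_n.

Lemma size_fps_inv_coefs n : size (fps_inv_coefs n) = n.
Proof. by elim: n => //= n IHn; rewrite size_rcons IHn. Qed.

Lemma nth_fps_inv_coefs n i : (i < n)%N -> (fps_inv_coefs n)`_i = fps_inv i.
Proof.
elim: n => // n IHn; rewrite ltnS leq_eqVlt => /orP[/eqP -> //|lt_in].
by rewrite /= nth_rcons size_fps_inv_coefs lt_in IHn.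
Qed.

Lemma fps_invE n :
  fps_inv n = (a 0)^-1 * ((n == 0)%:R - \sum_(i < n) a (n - i)%N * fps_inv i).
Proof.
rewrite {1}/fps_inv /= nth_rcons size_fps_inv_coefs ltnn eqxx.
congr (_ * (_ - _)); apply: eq_bigr => i _.
by rewrite nth_fps_inv_coefs.
Qed.

Lemma fps_mulV :
  a 0 != 0 -> fps_act a (fps_inv : fps K^o) = fps_of_seq [:: 1 : K].
Proof.
move=> a0; apply: funext => n; rewrite /fps_act /fps_of_seq.
rewrite big_ord_recl subn0 /= [fps_inv n]fps_invE /GRing.scale /=.
rewrite mulVKf // [X in _ - X](reindex_inj rev_ord_inj) /=.
rewrite -addrA [X in _ + X](_ : _ = 0) ?addr0.
  by case: n => [|n] //=; rewrite nth_nil.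
apply/eqP; rewrite addrC subr_eq0; apply/eqP/eq_bigr => i _.
by rewrite /bump leq0n add1n subKn.
Qed.

End Inverse.

Definition fps_div (K : fieldType) (V : lmodType K) (u : fps V) (a : fps K) :
    fps V :=
  fps_act (fps_inv a) u.

(* Main.v *)
(* F_n satisfies F_{n+2} = h F_{n+1} + F_n, hence so does each coordinate of
   Q_n; multiplying the series G by 1 - h t - t^2 therefore kills every
   coefficient beyond t^1. Associativity of the Cauchy product lets one divide
   by the invertible series 1 - h t - t^2. *)
Require Import Defs.
From HB Require Import structures.
From mathcomp Require Import all_boot all_order all_algebra.
From mathcomp Require Import boolp reals.

Set Implicit Arguments.
Unset Strict Implicit.
Unset Printing Implicit Defensive.

Import GRing.Theory.
Local Open Scope ring_scope.

Lemma fps_act_rev (K : fieldType) (V : lmodType K) (a : fps K) (u : fps V) n :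
  fps_act a u n = \sum_(i < n.+1) a (n - i)%N *: u i.
Proof.
rewrite /fps_act (reindex_inj rev_ord_inj) /=.
by apply: eq_bigr => i _; rewrite subSS subKn // -ltnS.
Qed.

Lemma fps_mulC (K : fieldType) (a b : fps K) :
  fps_act a (b : fps K^o) = fps_act b (a : fps K^o).
Proof.
apply: funext => n; rewrite fps_act_rev /fps_act.
by apply: eq_bigr => i _; rewrite /GRing.scale /= mulrC.
Qed.

(** At t^n both sides sum [(a i * b j) *: u k] over i + j + k = n, grouped by [i] on the left and by
    [k] on the right. *)
Lemma fps_actA (K : fieldType) (V : lmodType K) (a b : fps K) (u : fps V) :
  fps_act a (fps_act b u) = fps_act (fps_act a (b : fps K^o) : fps K) u.
Proof.
apply: funext => n; rewrite [RHS]fps_act_rev [LHS]/fps_act.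
pose c i k := (a i * b (n - i - k)%N) *: u k.
(* A fixed inner range with a side condition lets the two sums be exchanged; the condition amounts
   to i + k <= n, symmetric in [i] and [k]. *)
transitivity (\sum_(i < n.+1) \sum_(k < n.+1 | (k <= n - i)%N) c i k).
  apply: eq_bigr => i _; rewrite fps_act_rev scaler_sumr.
  rewrite (big_ord_narrow_leq (leq_subr _ _)).
  by apply: eq_bigr => k _; rewrite scalerA.
rewrite (exchange_big_dep predT) //=; apply: eq_bigr => k _.
transitivity (\sum_(i < n.+1 | (i <= n - k)%N) c i k).
  by apply: eq_bigl => i; rewrite !leq_subRL -1?ltnS // addnC.
rewrite (big_ord_narrow_leq (leq_subr _ _)) scaler_suml.
by apply: eq_bigr => i _; rewrite /c -!subnDA addnC.
Qed.

Lemma fps_act1 (K : fieldType) (V : lmodType K) (u : fps V) :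
  fps_act (fps_of_seq [:: 1 : K]) u = u.
Proof.
apply: funext => n; rewrite /fps_act big_ord_recl subn0 scale1r big1 ?addr0 //.
by move=> i _; rewrite /fps_of_seq /= nth_nil scale0r.
Qed.

(** Commutativity of scalar series turns the right inverse [fps_inv a] into a left one. *)
Lemma fps_actK (K : fieldType) (V : lmodType K) (a : fps K) (u : fps V) :
  a 0%N != 0 -> fps_div (fps_act a u) a = u.
Proof. by move=> a0; rewrite /fps_div fps_actA fps_mulC fps_mulV ?fps_act1. Qed.

Lemma hfibA_rec (R : realType) (k : scalar_kind) (m : nat)
    (A : unitaryAlgType (scalars R k)) (e : m.+1.-tuple A) (h : {poly R})
    (x : R) (n : nat) :
  hfibA e h x n.+2 = of_real R k h.[x] *: hfibA e h x n.+1 + hfibA e h x n.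
Proof.
rewrite /hfibA scaler_sumr -big_split; apply: eq_bigr => j _ /=.
(* [n.+2 + j] computes to [(n + j).+2], so [hfib] unfolds to its recurrence. *)
by rewrite hornerD hornerM rmorphD rmorphM scalerDl scalerA.
Qed.

Lemma fps_act_quadratic (K : fieldType) (V : lmodType K) (c : K) (u : fps V) :
  (forall n, u n.+2 = c *: u n.+1 + u n) ->
  fps_act (fps_of_seq (1 - c *: 'X - 'X^2 : {poly K})) u =
  fps_of_seq [:: u 0%N; u 1%N - c *: u 0%N].
Proof.
move=> u_rec; apply: funext => n; rewrite /fps_act /fps_of_seq.
under eq_bigr => i _ do rewrite !coefB coefZ coef1 coefX coefXn.
case: n => [|[|n]].
- by rewrite big_ord1 /= mulr0 !subr0 scale1r.
- rewrite !big_ord_recl big_ord0 /= mulr0 mulr1 !subr0 sub0r scale1r addr0.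
  by rewrite scaleNr.
(* The terms beyond the first three carry coefficients of degree at least 3, which vanish. *)
rewrite !big_ord_recl big1 => [|i _].
  rewrite /= !(mulr0, mulr1, subr0, sub0r, scale1r, addr0, scaleNr, oppr0).
  by rewrite u_rec subn2 nth_nil subn1 /= addrACA addrA subrr add0r subrr.
by rewrite /= mulr0 !subr0 scale0r.
Qed.

Theorem theorem3p6 (R : realType) (k : scalar_kind) (m : nat)
    (A : unitaryAlgType (scalars R k)) (e : m.+1.-tuple A)
    (he : basis_of fullv e) (h : {poly R}) (x : R) :
  let hx : scalars R k := of_real R k h.[x] in
  let Q : nat -> A := hfibA e h x in
  gen_fun Q =
  fps_div (fps_of_seq [:: Q 0%N; Q 1%N - hx *: Q 0%N])
          (fps_of_seq (1 - hx *: 'X - 'X^2 : {poly scalars R k})).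
Proof.
move=> hx Q; rewrite -(fps_act_quadratic (hfibA_rec e h x)) fps_actK //.
(* What remains is invertibility of the denominator: its constant term is 1. *)
rewrite /fps_of_seq !coefB coefZ coef1 coefX coefXn /= mulr0 !subr0.
exact: oner_neq0.
Qed.
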